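(* For every integer $d \ge 3$ there is a constant $f(d)$ (depending only on $d$) such that for every $h \ge 1$ the partial order $\mathcal{T}^h$ has a $d$-hitting family of schedules of size at most $f(d)\, h^{d-1}$ (i.e. of size $O(h^{d-1})$, which is $O((\log n)^{d-1})$ where $n = 2^{h+1}-1$ is the number of elements of $\mathcal{T}^h$).
   Context: $\mathcal{T}^h$ is the partial order on the set $\{0,1\}^{\le h}$ of binary strings of length at most $h$, where $x \le y$ iff $x$ is a prefix of $y$ (the complete binary tree of height $h$). A schedule of a finite partial order $(P,\le)$ is a linear extension of it. A $d$-tuple $(a_1,\dots,a_d)$ of distinct elements of $P$ is admissible if for all $i<j$ either $a_i \le a_j$ or $a_i,a_j$ are incomparable. A schedule hits $(a_1,\dots,a_d)$ if its restriction to $\{a_1,\dots,a_d\}$ is the sequence $a_1,\dots,a_d$. A family of schedules is $d$-hitting if every admissible $d$-tuple is hit by some schedule in the family. *)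

(* Defs.v *)
From HB Require Import structures.
From mathcomp Require Import all_boot all_order.

Set Implicit Arguments.
Unset Strict Implicit.
Unset Printing Implicit Defensive.

Import Order.TTheory.

Section Schedules.
Variables (disp : Order.disp_t) (P : finPOrderType disp).

(* A linear extension is given by the sequence listing all elements of P,
   each exactly once, in increasing order. *)
Definition schedule (s : seq P) : Prop :=
  [/\ uniq s,
      (forall x : P, x \in s) &
      (forall x y : P, (x < y)%O -> index x s < index y s)].

Definition admissible (d : nat) (a : d.-tuple P) : Prop :=
  uniq a /\
  (forall i j : 'I_d, i < j ->
     (tnth a i <= tnth a j)%O \/ (tnth a i >< tnth a j)%O).

Definition hits (d : nat) (s : seq P) (a : d.-tuple P) : Prop :=
  [seq x <- s | x \in a] = a.

Definition hitting_family (d : nat) (F : seq (seq P)) : Prop :=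
  (forall s, s \in F -> schedule s) /\
  (forall a : d.-tuple P, admissible a -> exists2 s, s \in F & hits s a).

End Schedules.

Definition tree (h : nat) : predArgType := {bseq h of bool}.

HB.instance Definition _ (h : nat) := Finite.on (tree h).

Section TreeOrder.
Variable h : nat.

Definition tree_le (x y : tree h) : bool := prefix (bseqval x) (bseqval y).

Fact tree_le_refl : reflexive tree_le.
Proof. by move=> x; apply: prefix_refl. Qed.

Fact tree_le_anti : antisymmetric tree_le.
Proof.
move=> x y /andP[]; rewrite /tree_le => /prefixP[u yE] /prefixP[v xE].
apply: val_inj => /=; rewrite yE; move/(congr1 size): xE.
rewrite yE !size_cat -addnA -[LHS]addn0 => /addnI/esym/eqP.
by rewrite addn_eq0 => /andP[/nilP-> _]; rewrite cats0.
Qed.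

Fact tree_le_trans : transitive tree_le.
Proof. by move=> y x z; apply: prefix_trans. Qed.

End TreeOrder.

Fact tree_display : Order.disp_t. Proof. exact: (Order.Disp tt tt). Qed.

HB.instance Definition _ (h : nat) :=
  Order.Le_isPOrder.Build tree_display (tree h)
    (@tree_le_refl h) (@tree_le_anti h) (@tree_le_trans h).

Lemma tree_leE (h : nat) (x y : tree h) :
  (x <= y)%O = prefix (bseqval x) (bseqval y).
Proof. by []. Qed.

(* Main.v *)
Require Import Defs.
From mathcomp Require Import all_boot all_order.

(** The length of the longest common prefix is an inverted ultrametric, so the
    pairs of distinct entries of a [d]-tuple [a] of strings branch on at most
    [d - 1] levels.  Prescribing the letters of [a_j] on these levels defines an
    upset [U_j] of the tree that contains [a_i] exactly when [a_j] is a prefix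
    of [a_i].  If [a] is admissible this forces [j <= i], so that the monotone
    function [w |-> max {j | w \in U_j}] maps [a_i] to [i], and sorting by it
    gives a schedule hitting [a].  There are [h ^ (d - 1)] choices of the
    levels, and the number of choices of the letters depends on [d] alone. *)

Set Implicit Arguments.
Unset Strict Implicit.
Unset Printing Implicit Defensive.

Import Order.TTheory.

Section SortedSchedules.
Variables (disp : Order.disp_t) (P : finPOrderType disp).
Variables (disp' : Order.disp_t) (D : orderType disp') (key : P -> D).

Definition sort_by : seq P := sort (relpre key <=%O) (enum P).

Let key_trans : transitive (relpre key <=%O).
Proof. by move=> y x z; apply: le_trans. Qed.

Let key_total : total (relpre key <=%O).
Proof. by move=> x y; apply: le_total. Qed.

Lemma sort_by_schedule : {homo key : x y / (x < y)%O} -> schedule sort_by.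
Proof.
have mem_sort_by x : x \in sort_by by rewrite mem_sort mem_enum.
move=> key_homo; split=> // [|x y /key_homo].
  by rewrite sort_uniq enum_uniq.
apply: contraTT; rewrite -leqNgt -leNgt.
apply: (sorted_leq_index key_trans _ (sort_sorted key_total _)) => // z.
exact: lexx.
Qed.

Lemma sort_by_hits d (a : d.-tuple P) :
  sorted <%O (map key a) -> hits sort_by a.
Proof.
rewrite lt_sorted_uniq_le sorted_map => /andP[key_uniq key_sorted].
have key_inj : {in a &, injective key}.
  have /tuple_uniqP inj_tnth : uniq (map_tuple key a) by [].
  move=> _ _ /tnthP[i ->] /tnthP[j ->]; rewrite -!(tnth_map key).
  by move/inj_tnth->.
rewrite /hits filter_sort // -[RHS](sorted_sort key_trans key_sorted).
apply/perm_sort_inP.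
- by move=> x y _ _; apply: key_total.
- by move=> y x z _ _ _; apply: key_trans.
- move=> x y; rewrite !mem_filter => /andP[xa _] /andP[ya _] /le_anti.
  exact: key_inj.
apply: uniq_perm => [||x]; last by rewrite mem_filter mem_enum andbT.
  by rewrite filter_uniq ?enum_uniq.
exact: map_uniq key_uniq.
Qed.

End SortedSchedules.

Section UpsetSchedules.
Variables (disp : Order.disp_t) (P : finPOrderType disp).

Definition upset (A : {set P}) : Prop :=
  forall x y : P, (x <= y)%O -> x \in A -> y \in A.

Definition rank (x : P) : nat := #|[set y | (y < x)%O]|.

Lemma rank_homo : {homo rank : x y / (x < y)%O >-> x < y}.
Proof.
move=> x y lt_xy; apply/proper_card/properP; split.
  by apply/subsetP => z; rewrite !inE => /lt_trans; apply.
by exists x; rewrite !inE ?ltxx.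
Qed.

Lemma admissible_le d (a : d.-tuple P) i j :
  admissible a -> (tnth a j <= tnth a i)%O -> j <= i.
Proof.
case=> /tuple_uniqP a_inj a_adm le_ji; rewrite leqNgt; apply/negP => lt_ij.
case: (a_adm i j lt_ij) => [le_ij|]; last first.
  by rewrite /Order.comparable le_ji orbT.
have eq_ij : i = j by apply/a_inj/le_anti; rewrite le_ij.
by rewrite eq_ij ltnn in lt_ij.
Qed.

Section Phase.
Variables (d : nat) (U : 'I_d -> {set P}).

Definition phase (x : P) : nat := \max_(j < d | x \in U j) j.

Definition upset_schedule : seq P :=
  sort_by (fun x => (phase x, rank x) : nat *l nat).

Lemma phase_homo :
  (forall j, upset (U j)) -> {homo phase : x y / (x <= y)%O >-> x <= y}.
Proof.
move=> U_up x y le_xy; apply/bigmax_leqP => j x_j.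
by apply: (leq_bigmax_cond (P := fun j => y \in U j)); apply: U_up x_j.
Qed.

Lemma upset_schedule_schedule :
  (forall j, upset (U j)) -> schedule upset_schedule.
Proof.
move=> U_up; apply: sort_by_schedule => x y lt_xy.
rewrite ltxi_pair !leEnat ltEnat /= rank_homo // implybT andbT.
exact: phase_homo (ltW lt_xy).
Qed.

Lemma upset_schedule_hits (a : d.-tuple P) :
    admissible a ->
    (forall i j, (tnth a i \in U j) = (tnth a j <= tnth a i)%O) ->
  hits upset_schedule a.
Proof.
move=> a_adm U_a; have phase_a i : phase (tnth a i) = i.
  apply/eqP; rewrite eqn_leq; apply/andP; split.
    by apply/bigmax_leqP => j; rewrite U_a; apply: admissible_le.
  by apply: (leq_bigmax_cond (P := fun j => _ \in U j)); rewrite U_a.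
have : sorted ltn (map phase a).
  rewrite -[X in map _ X]map_tnth_enum -map_comp.
  by rewrite (eq_map phase_a) val_enum_ord iota_ltn_sorted.
rewrite sorted_map => a_sorted; apply: sort_by_hits; rewrite sorted_map.
apply: sub_sorted a_sorted => x y /= lt_xy.
by rewrite ltxi_pair !leEnat (ltnW lt_xy) leqNgt lt_xy.
Qed.

End Phase.
End UpsetSchedules.

Section InvertedUltrametric.
Variables (disp : Order.disp_t) (D : orderType disp).
Variables (T : eqType) (m : T -> T -> D).
Hypothesis m_sym : forall x y, m x y = m y x.
Hypothesis m_ultra : forall x y z, (Order.min (m x y) (m y z) <= m x z)%O.

Lemma ultrametric_isosceles x y z : (m x z < m x y)%O -> m y z = m x z.
Proof.
move=> lt_zy; apply: le_anti; apply/andP; split.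
  by have := m_ultra x y z; rewrite ge_min leNgt lt_zy.
by rewrite -(min_r (ltW lt_zy)) (m_sym x y).
Qed.

Lemma ultrametric_values (s : seq T) :
  exists2 K : seq D, size K <= (size s).-1 &
    {in s &, forall x y, x != y -> m x y \in K}.
Proof.
elim: s => [|x s [K szK mK]]; first by exists [::].
suff [K' szK' [subK newK]] : exists2 K' : seq D, size K' <= size s &
    {subset K <= K'} /\ {in s, forall y, m x y \in K'}.
  exists K' => // y z; rewrite !inE => /predU1P[->|ys] /predU1P[->|zs] //.
  - by rewrite eqxx.
  - by rewrite newK.
  - by rewrite m_sym newK.
  by move=> yz; apply/subK/mK.
(* At most one value of [m x] on [s] is missing from [K]: if [m x y] and [m x z]
   differ, then the smaller of them is equal to [m y z]. *)
have [/allP K_x|/allPn[y ys y_new]] := boolP (all (fun y => m x y \in K) s).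
  by exists K; [apply: leq_trans szK (leq_pred _) | split].
have s_gt0 : 0 < size s by rewrite -has_predT; apply/hasP; exists y.
exists (m x y :: K); first by rewrite -(prednK s_gt0).
split=> [k|z zs]; first by rewrite inE orbC => ->.
rewrite inE; have [lt_xz|lt_xy|//] := ltgtP (m x z) (m x y).
  rewrite -(ultrametric_isosceles lt_xz) mK ?orbT //.
  by apply: contraTneq lt_xz => ->; rewrite ltxx.
case/negP: y_new; rewrite -(ultrametric_isosceles lt_xy) mK //.
by apply: contraTneq lt_xy => ->; rewrite ltxx.
Qed.

End InvertedUltrametric.

Section CommonPrefix.
Variable T : eqType.
Implicit Types (x y z : seq T) (k : nat).

Fixpoint lcp x y : nat :=
  match x, y with
  | a :: x', b :: y' => if a == b then (lcp x' y').+1 else 0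
  | _, _ => 0
  end.

Lemma lcpC x y : lcp x y = lcp y x.
Proof. by elim: x y => [|a x IHx] [|b y] //=; rewrite eq_sym IHx. Qed.

Lemma min_lcp x y z : minn (lcp x y) (lcp y z) <= lcp x z.
Proof.
elim: x y z => [|a x IHx] [|b y] [|c z] //=; rewrite ?minn0 ?min0n //.
have [->|_] := eqVneq a b; last by rewrite min0n.
by case: eqVneq => // _; rewrite ?minn0 // minnSS ltnS.
Qed.

Lemma lcp_lt_maxn x y : x != y -> lcp x y < maxn (size x) (size y).
Proof.
elim: x y => [|a x IHx] [|b y] //=; rewrite eqseq_cons maxnSS ltnS.
by case: eqVneq => //= _ /IHx.
Qed.

Definition flat_le : rel (option T) := fun o o' => (o == None) || (o == o').

Lemma flat_le_trans : transitive flat_le.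
Proof. by move=> o' o o'' /predU1P[->|/eqP->]. Qed.

Lemma prefix_flat_le x y k : prefix x y -> flat_le (onth x k) (onth y k).
Proof.
move=> /prefixP[z ->]; rewrite onth_cat; have [_|le_xk] := ltnP k (size x).
  by rewrite /flat_le eqxx orbT.
by rewrite onth_default.
Qed.

(* If [x] ends at level [lcp x y], then [onth x (lcp x y)] is [None] and [x] is
   a prefix of [y] anyway. *)
Lemma flat_le_lcp x y :
  flat_le (onth x (lcp x y)) (onth y (lcp x y)) = prefix x y.
Proof.
rewrite /flat_le; elim: x y => [|a x IHx] [|b y] //=.
by have [->|/negPf neq_ab] := eqVneq a b; [apply: IHx | apply: neq_ab].
Qed.

End CommonPrefix.

Section Cylinders.
Variables h e : nat.

Definition cylinder (k : {ffun 'I_e -> 'I_h}) (p : {ffun 'I_e -> option bool}) :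
    {set tree h} :=
  [set w : tree h | [forall t, flat_le (p t) (onth w (k t))]].

Lemma cylinder_upset k p : upset (cylinder k p).
Proof.
move=> v w; rewrite tree_leE !inE => le_vw /forallP v_p.
by apply/forallP => t; apply: flat_le_trans (v_p t) (prefix_flat_le _ le_vw).
Qed.

Variable d : nat.

Definition cylinder_code : finType :=
  ({ffun 'I_e -> 'I_h} * {ffun 'I_d -> {ffun 'I_e -> option bool}})%type.

Definition cylinders (c : cylinder_code) (j : 'I_d) : {set tree h} :=
  cylinder c.1 (c.2 j).

Lemma card_cylinder_code : #|cylinder_code| = h ^ e * 3 ^ (e * d).
Proof.
by rewrite card_prod !card_ffun card_option card_bool !card_ord -expnM.
Qed.

End Cylinders.

Lemma cylinders_separate h d (a : d.-tuple (tree h)) : 0 < h ->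
  exists c : cylinder_code h d.-1 d,
    forall i j, (tnth a i \in cylinders c j) = (tnth a j <= tnth a i)%O.
Proof.
case: h a => // h a _.
have [K szK lcpK] :=
  ultrametric_values (@lcpC bool) (@min_lcp bool) (map val a).
rewrite size_map size_tuple in szK.
pose level (t : 'I_d.-1) : 'I_h.+1 := inord (nth 0 K t).
pose letters j := [ffun t => onth (tnth a j) (level t)].
exists ([ffun t => level t], [ffun j => letters j]) => i j.
rewrite inE tree_leE; apply/forallP/idP => [pass|le_ji t]; last first.
  by rewrite !ffunE prefix_flat_le.
have [->|a_neq] := eqVneq (tnth a i) (tnth a j); first exact: prefix_refl.
have lcp_K : lcp (tnth a j) (tnth a i) \in K.
  by apply: lcpK; rewrite ?map_f ?mem_tnth // val_eqE eq_sym.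
have lt_t : index (lcp (tnth a j) (tnth a i)) K < d.-1.
  by rewrite (leq_trans _ szK) ?index_mem.
have level_t : level (Ordinal lt_t) = lcp (tnth a j) (tnth a i) :> nat.
  rewrite inordK nth_index // (leq_trans (lcp_lt_maxn _)) //.
    by rewrite val_eqE eq_sym.
  by rewrite geq_max !size_bseq.
by have := pass (Ordinal lt_t); rewrite !ffunE level_t flat_le_lcp.
Qed.

Lemma cylinder_schedules_hitting h d : 0 < h ->
  hitting_family d
    [seq upset_schedule (cylinders c) | c : cylinder_code h d.-1 d].
Proof.
move=> h_gt0; split=> [s /mapP[c _ ->]|a a_adm].
  by apply: upset_schedule_schedule => j; apply: cylinder_upset.
have [c c_a] := cylinders_separate a h_gt0.
exists (upset_schedule (cylinders c)); last exact: upset_schedule_hits.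
by apply: map_f; rewrite mem_enum.
Qed.

Lemma card_tree h : #|tree h| = 2 ^ (h + 1) - 1.
Proof.
rewrite (card_bseq h bool : #|tree h| = _) card_bool.
by rewrite subn1 predn_exp mul1n addn1.
Qed.

Lemma trunc_log_predn_exp p n : 1 < p -> trunc_log p (p ^ n.+1).-1 = n.
Proof.
move=> p_gt1; apply: trunc_log_eq => //.
have pn_gt0 : 0 < p ^ n.+1 by rewrite expn_gt0 ltnW.
by rewrite -ltnS prednK // ltn_exp2l // ltnSn leqnn.
Qed.

Theorem theorem3 (d : nat) (hd : 3 <= d) :
  exists c : nat, forall h : nat, 1 <= h ->
    #|tree h| = 2 ^ (h + 1) - 1 /\
    exists F : seq (seq (tree h)),
      [/\ hitting_family d F,
          size F <= c * h ^ (d - 1) &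
          size F <= c * trunc_log 2 #|tree h| ^ (d - 1)].
Proof.
exists (3 ^ (d.-1 * d)) => h h_gt0; split; first exact: card_tree.
exists [seq upset_schedule (cylinders c) | c : cylinder_code h d.-1 d].
have log_card : trunc_log 2 #|tree h| = h.
  by rewrite card_tree addn1 subn1 trunc_log_predn_exp.
rewrite log_card size_map -cardT card_cylinder_code mulnC subn1.
by split=> //; apply: cylinder_schedules_hitting.
Qed.
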